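(* The number of sets $A\subseteq[n]$ satisfying $n+1\notin 3A$ is $O(2^{2n/3})$ (as $n\to\infty$).
   Context: $[n]=\{1,\ldots,n\}$, and $3A=\{a_1+a_2+a_3\mid a_1,a_2,a_3\in A\}$ (repetitions allowed). *)

(* Defs.v *)
From mathcomp Require Import all_boot all_order all_algebra finmap.

Set Implicit Arguments.
Unset Strict Implicit.
Unset Printing Implicit Defensive.

Local Open Scope fset_scope.

(* [n] = {1, ..., n} *)
Definition interval1 (n : nat) : {fset nat} := [fset i in iota 1 n].

(* 3A; the indices range over triples in A, so repetitions are allowed. *)
Definition sumset3 (A : {fset nat}) : {fset nat} :=
  [fset (a.1.1 + a.1.2 + a.2)%N | a in (A `*` A) `*` A].

Definition sum3_avoiding_sets (n : nat) : {fset {fset nat}} :=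
  [fset A in fpowerset (interval1 n) | (n + 1)%N \notin sumset3 A].

(* Main.v *)
Require Import Defs.
From mathcomp Require Import all_boot all_order all_algebra finmap.
From mathcomp Require Import zify ring lra.
Import Order.TTheory GRing.Theory Num.Theory.

(** Put N = n + 1 and let a be the least element of A. If 3a > N, then A is one
    of at most 2^(2N/3) subsets of (N/3, N). Otherwise, the at most 2a elements
    of A beyond N - 2a are free, which costs 4^a, and it suffices to show that
    the part of A in V = [a, N - 2a], a window of l = N - 3a + 1 integers, takes
    O(1.58^l) values: as 1.58^3 < 4, the sum over a of 4^a 1.58^(N - 3a) is
    geometric and bounded by a constant times 4^(N/3).
    With m = l/4, fix a large constant k.
    - If A has k elements in [a, a + m], let T consist of k of them. Then A is
      independent in the graph on V whose edges join u and w when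
      N - u - w is in T. All vertices but m have degree k, so this graph behaves
      like a regular one: after branching on vertices of large degree, at most
      about (l + m)/2 vertices remain.
    - If A has fewer than k elements in [a, a + m], this part of A takes
      polynomially many values, the last m elements of V are free, and those in
      between contain no pair {t, N - a - t}. *)

Set Implicit Arguments.
Unset Strict Implicit.
Unset Printing Implicit Defensive.

Local Open Scope ring_scope.

(** * Counting set families and independent sets *)

Lemma card_split (V : finType) (F G H : {set {set V}}) (X Y : {set V}) :
  (forall A, A \in F ->
    [/\ A \subset X :|: Y, A :&: X \in G & A :&: Y \in H]) ->
  (#|F| <= #|G| * #|H|)%N.
Proof.
move=> FP; rewrite -cardsX.
have inj : {in F &, injective (fun A => (A :&: X, A :&: Y))}.
  move=> A B /FP[/setIidPl AXY _ _] /FP[/setIidPl BXY _ _] [eX eY].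
  by rewrite -AXY -BXY !setIUr eX eY.
rewrite -(card_in_imset inj); apply/subset_leq_card/subsetP => _ /imsetP[A AF ->].
by have [_ AG AH] := FP A AF; rewrite inE /= AG.
Qed.

(** Pairs with [x = y] count too, so a vertex with a loop lies in no independent set. This matches
    the repetitions allowed in 3A. *)
Definition indep (V : finType) (e : rel V) (U : {set V}) : {set {set V}} :=
  [set I : {set V} | (I \subset U) && [forall x in I, forall y in I, ~~ e x y]].

Lemma indepP (V : finType) (e : rel V) (U I : {set V}) :
  reflect (I \subset U /\ {in I &, forall x y, ~~ e x y}) (I \in indep e U).
Proof.
rewrite inE; apply: (iffP andP) => -[IU Ie]; split=> //.
  by move=> x y xI yI; have /forall_inP/(_ x xI)/forall_inP/(_ y yI) := Ie.
by apply/forall_inP => x xI; apply/forall_inP => y; apply: Ie.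
Qed.

Lemma indep_sub (V : finType) (e : rel V) (U X I : {set V}) :
  I \in indep e U -> I :&: X \in indep e (U :&: X).
Proof.
move=> /indepP[IU Ie]; apply/indepP; split; first exact: setSI.
by move=> x y; rewrite !inE => /andP[xI _] /andP[yI _]; apply: Ie.
Qed.

Lemma card_indep_setU (V : finType) (e : rel V) (U X Y : {set V}) :
  U \subset X :|: Y -> (#|indep e U| <= #|indep e X| * #|indep e Y|)%N.
Proof.
move=> UXY; apply: (card_split (X := X) (Y := Y)) => I IU.
have h Z : I :&: Z \in indep e Z.
  have /indepP[_ Ie] := indep_sub Z IU.
  by apply/indepP; split; rewrite ?subsetIr.
by split=> //; apply: subset_trans UXY; have /indepP[] := IU.
Qed.

Lemma card_indep_le2 (V : finType) (e : rel V) (U : {set V}) :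
  (#|indep e U| <= 2 ^ #|U|)%N.
Proof.
rewrite -card_powerset; apply/subset_leq_card/subsetP => I /indepP[IU _].
by rewrite inE.
Qed.

(** An independent set that contains [v] avoids all neighbours of [v] and can be recovered after [v]
    is removed; any other one already lies in [U :\ v]. *)
Lemma card_indep_branch (V : finType) (e : rel V) (U : {set V}) (v : V) :
  (#|indep e U| <= #|indep e (U :\ v)| +
     #|indep e ((U :\ v) :\: [set w in U | e v w])|)%N.
Proof.
set F := indep e U.
have -> : F = [set I in F | v \notin I] :|: [set I in F | v \in I].
  by apply/setP => I; rewrite !inE -andb_orr orNb andbT.
apply: leq_trans (leq_card_setU _ _) _; apply: leq_add.
  apply/subset_leq_card/subsetP => I; rewrite inE => /andP[/indepP[IU Ie] vI].
  by apply/indepP; split=> //; rewrite subsetD1 IU.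
have inj : {in [set I in F | v \in I] &, injective (fun I : {set V} => I :\ v)}.
  move=> I J; rewrite !inE => /andP[_ vI] /andP[_ vJ] e1.
  by rewrite -(setD1K vI) -(setD1K vJ) e1.
rewrite -(card_in_imset inj); apply/subset_leq_card/subsetP => _ /imsetP[I + ->].
rewrite inE => /andP[/indepP[IU Ie] vI]; apply/indepP; split.
  apply/subsetP => x; rewrite !inE => /andP[xv xI].
  by rewrite xv (subsetP IU) // (negPf (Ie _ _ vI xI)).
by move=> x y; rewrite !inE => /andP[_ xI] /andP[_ yI]; apply: Ie.
Qed.

(* As long as some vertex has [K] neighbours left, deciding whether it belongs
   to the independent set costs one vertex in one branch and [K] in the other;
   [lam] is chosen so that these branchings are paid for by [lam ^+ #|U|]. *)
Lemma card_indep_greedy (R : realFieldType) (V : finType) (e : rel V)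
    (V0 : {set V}) (K : nat) (lam B : R) :
  1 <= lam -> 1 <= lam ^+ K * (lam - 1) ->
  (forall U : {set V}, U \subset V0 ->
     {in U, forall v, (#|[set w in U | e v w]| <= K)%N} -> 2 ^+ #|U| <= B) ->
  forall U : {set V}, U \subset V0 -> #|indep e U|%:R <= lam ^+ #|U| * B.
Proof.
move=> lam1 lamK term U; have [s] := ubnP #|U|.
have lam0 : 0 < lam by lra.
have B0 : 0 <= B.
  apply: le_trans (_ : 2 ^+ #|set0 : {set V}| <= B).
    by rewrite cards0 expr0 ler01.
  by apply: term; [rewrite sub0set | move=> v; rewrite inE].
elim: s U => // s IH U; rewrite ltnS => Us UV0.
have [big|small] := boolP [exists v in U, (K < #|[set w in U | e v w]|)%N].
  have /exists_inP[v vU Kv] := big.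
  have cv : #|U| = #|U :\ v|.+1 by rewrite (cardsD1 v U) vU.
  have h1 : #|indep e (U :\ v)|%:R <= lam ^+ #|U :\ v| * B.
    by apply: IH; [rewrite -cv in Us *; lia | apply: subset_trans UV0; apply: subsetDl].
  set N := [set w in U | e v w] in Kv *.
  (* A loop may put [v] itself into [N]; as [N] has more than [K] elements, at least [K] vertices
     other than [v] still disappear. *)
  have cN : (#|(U :\ v) :\: N| + K <= #|U :\ v|)%N.
    have : (#|(U :\ v) :\: N| <= #|U :\: N|)%N by apply/subset_leq_card/setSD/subsetDl.
    have NU : N \subset U by apply/subsetP => w; rewrite inE => /andP[].
    have := cardsID N U; rewrite (setIidPr NU); lia.
  have h2 : #|indep e ((U :\ v) :\: N)|%:R <= lam ^+ #|(U :\ v) :\: N| * B.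
    apply: IH; first by lia.
    by apply: subset_trans UV0; apply: subset_trans (subsetDl _ _) (subsetDl _ _).
  have := card_indep_branch e U v; rewrite -(ler_nat R) natrD => /le_trans; apply.
  apply: le_trans (lerD h1 h2) _.
  rewrite cv -mulrDl; apply: ler_wpM2r => //.
  (* Once [lam ^+ p] is factored out, the claim is lam^q + 1 <= lam^(q+1), which follows from [lamK]
     because q >= K. *)
  rewrite -(subnKC (leq_trans (leq_addr _ _) cN)).
  set p := #|_ :\: N| in cN *; set q := (_ - p)%N.
  rewrite -addnS !exprD -{2}[lam ^+ p]mulr1 -mulrDr; apply: ler_wpM2l; first exact: exprn_ge0 (ltW lam0).
  have Kq : (K <= q)%N by rewrite /q; lia.
  have : lam ^+ K * (lam - 1) <= lam ^+ q * (lam - 1).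
    by apply: ler_wpM2r; [lra | apply: ler_weXn2l].
  rewrite exprS; lra.
have U2 : 2 ^+ #|U| <= B.
  apply: term => // v vU; rewrite leqNgt; apply: contra small => Kv.
  by apply/exists_inP; exists v.
apply: le_trans (_ : 2 ^+ #|U| <= _).
  by rewrite -natrX ler_nat card_indep_le2.
apply: le_trans U2 _; rewrite -{1}[B]mul1r; apply: ler_wpM2r => //.
exact: exprn_ege1.
Qed.

(** The involution cuts [U] into pairs and fixed points. A pair is an edge, so at most 3 of its 4
    subsets are independent; a fixed point carries a loop, so only the empty set remains. *)
Lemma card_indep_matching (R : realFieldType) (V : finType) (e : rel V)
    (th : R) (U : {set V}) (f : V -> V) :
  1 <= th -> 3 <= th ^+ 2 ->
  {in U, forall x, [/\ f x \in U, f (f x) = x & e x (f x)]} ->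
  #|indep e U|%:R <= th ^+ #|U|.
Proof.
move=> th1 th3; have [s] := ubnP #|U|; elim: s U => // s IH U.
rewrite ltnS => Us fU.
have [->|[x xU]] := set_0Vmem U.
  rewrite cards0 expr0 -[1]/(1%:R : R) ler_nat.
  by apply: leq_trans (card_indep_le2 _ _) _; rewrite cards0.
have [fxU ffx exfx] := fU x xU.
pose P := [set x; f x].
have PU : P \subset U by rewrite subUset !sub1set xU.
have cP := cardsID P U; rewrite (setIidPr PU) in cP.
have hD : #|indep e (U :\: P)|%:R <= th ^+ #|U :\: P|.
  apply: IH.
    have : (0 < #|P|)%N by rewrite card_gt0; apply/set0Pn; exists x; rewrite !inE eqxx.
    lia.
  move=> y; rewrite !inE => /andP[yP yU]; have [fyU ffy eyfy] := fU y yU.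
  split=> //; rewrite fyU andbT; apply: contra yP => /orP[/eqP|/eqP] h.
    by rewrite -ffy h eqxx orbT.
  by rewrite -ffy h ffx eqxx.
have split : (#|indep e U| <= #|indep e P| * #|indep e (U :\: P)|)%N.
  by apply: card_indep_setU; rewrite -{1}(setIidPr PU) setID.
have hP : #|indep e P|%:R <= th ^+ #|P|.
  have [fx|fx] := eqVneq (f x) x.
    have -> : indep e P = [set set0].
      apply/setP => I; rewrite in_set1; apply/indepP/eqP => [[IP Ie]|->].
        apply/setP => y; rewrite inE; apply/negP => yI.
        have := subsetP IP y yI; rewrite !inE fx orbb => /eqP yx.
        by move: exfx; rewrite fx -yx; apply/negP; apply: Ie.
      by split; [rewrite sub0set | move=> y z; rewrite inE].
    by rewrite cards1 exprn_ege1.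
  have cP2 : #|P| = 2%N by rewrite cards2 eq_sym fx.
  rewrite cP2; apply: le_trans th3; rewrite ler_nat.
  have : (#|indep e P| <= #|powerset P :\ P|)%N.
    apply/subset_leq_card/subsetP => I /indepP[IP Ie]; rewrite in_setD1 powersetE IP andbT.
    apply: contraL exfx => /eqP IPe; apply: Ie; rewrite IPe !inE eqxx ?orbT //.
  have := cardsD1 P (powerset P); rewrite card_powerset cP2 powersetE subxx.
  by move=> /(congr1 predn) /=; rewrite add0n => <-.
apply: le_trans (_ : (#|indep e P| * #|indep e (U :\: P)|)%:R <= _).
  by rewrite ler_nat.
by rewrite natrM -cP exprD; apply: ler_pM.
Qed.

(** * Windows of integers, small subsets and double counting *)

(** Subsets of [n] are represented in ['I_N] with N = n + 1, so that the bound of the type is also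
    the forbidden sum. *)
Definition window (N lo hi : nat) : {set 'I_N} := [set i : 'I_N | (lo <= i < hi)%N].

Lemma card_window (N lo hi : nat) : (#|window N lo hi| <= hi - lo)%N.
Proof.
rewrite cardE -(size_map val) -(size_iota lo (hi - lo)).
apply: uniq_leq_size; first by rewrite (map_inj_uniq val_inj) enum_uniq.
by move=> _ /mapP[i + ->]; rewrite mem_enum inE mem_iota /=; lia.
Qed.

(** For each j < k there are at most n^j <= n^k sets of size j. This polynomial factor is later
    absorbed by a slightly larger exponential base. *)
Lemma card_sets_lt (V : finType) (X : {set V}) (n k : nat) : (0 < n)%N ->
  (#|X| <= n)%N ->
  (#|[set S : {set V} | (S \subset X) && (#|S| < k)%N]| <= k * n ^ k)%N.
Proof.
move=> n0 Xn; elim: k => [|k IH].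
  by rewrite mul0n leqn0 cards_eq0; apply/eqP/setP => S; rewrite !inE ltn0 andbF.
have -> : [set S : {set V} | (S \subset X) && (#|S| < k.+1)%N] =
   [set S : {set V} | (S \subset X) && (#|S| < k)%N] :|:
   [set S : {set V} | (S \subset X) && (#|S| == k)].
  by apply/setP => S; rewrite !inE ltnS leq_eqVlt -andb_orr orbC.
apply: leq_trans (leq_card_setU _ _) _.
rewrite mulSnr; apply: leq_add.
  by apply: leq_trans IH _; rewrite leq_mul2l leq_pexp2l // orbT.
rewrite cards_draws; apply: leq_trans (_ : #|X| ^ k <= _)%N.
  apply: leq_trans (_ : #|X| ^_ k <= _)%N.
    by rewrite -bin_ffact leq_pmulr // fact_gt0.
  elim: k {IH} => [|k IH]; first by rewrite ffactn0.
  by rewrite ffactnSr expnSr leq_mul // leq_subr.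
apply: leq_trans (_ : n ^ k <= _)%N; last by rewrite leq_pexp2l.
by case: k {IH} => // k; rewrite leq_exp2r.
Qed.

Lemma sum_mem_le_card (V : finType) (X Y Z : {set V}) (g : V -> V) :
  {in X &, injective g} -> {in X, forall x, g x \in Y -> g x \in Z} ->
  (\sum_(x in X) (g x \in Y) <= #|Z|)%N.
Proof.
move=> ginj gZ; rewrite -big_mkcondr sum1dep_card.
have inj : {in [set x in X | g x \in Y] &, injective g}.
  by move=> x y; rewrite !inE => /andP[xX _] /andP[yX _]; apply: ginj.
rewrite -(card_in_imset inj); apply/subset_leq_card/subsetP => _ /imsetP[x + ->].
by rewrite inE => /andP[]; apply: gZ.
Qed.

(** * The graph defined by T *)

Definition link N (T : {set 'I_N}) : rel 'I_N :=
  fun u w => [exists t in T, (u + w + t)%N == N].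

(* Double counting of the pairs [(u, t)] with [u] in [U] far from the right end
   of the window and [t] in [T], according to whether [N - t - u] is in [U].
   For degree [D] in place of [17 * K], the ratio tends to 5/8 as [D / K] grows. *)
Lemma card_terminal N a m n K (T U : {set 'I_N}) :
  (0 < a)%N -> (3 * a <= N)%N -> n = (N - 3 * a).+1 -> (4 * m <= n)%N ->
  (0 < K)%N -> T \subset window N a (a + m).+1 -> #|T| = (17 * K)%N ->
  U \subset window N a (N - 2 * a).+1 ->
  {in U, forall u, (#|[set w in U | link T u w]| <= K)%N} ->
  (11 * #|U| <= 7 * n)%N.
Proof.
move=> a0 aN nE mn K0 Twin cT UV deg.
pose V := window N a (N - 2 * a).+1.
(* If u <= N - 2a - m and t <= a + m, then N - t - u >= a, so every vertex of [X] has all its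
   [17 * K] neighbours in [V]. *)
pose X := U :&: window N a (N - 2 * a - m).+1.
pose Y := V :\: U.
(* The default [u] is never taken: t >= a > 0 makes N - t - u smaller than N. *)
pose g (u t : 'I_N) : 'I_N := insubd u (N - t - u)%N.
have winT t : t \in T -> (a <= t < (a + m).+1)%N by move/(subsetP Twin); rewrite inE.
have winX u : u \in X -> (a <= u < (N - 2 * a - m).+1)%N by rewrite !inE => /andP[].
have gE u t : u \in X -> t \in T -> g u t = (N - t - u)%N :> nat.
  by move=> /winX uX /winT tT; rewrite /g val_insubd ifT //; lia.
have gV u t : u \in X -> t \in T -> g u t \in V.
  move=> uX tT; rewrite inE gE //; have := winX u uX; have := winT t tT; lia.
have sU u : u \in X -> (\sum_(t in T) (g u t \in U) <= K)%N.
  move=> uX; have uU : u \in U by move: uX; rewrite inE => /andP[].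
  apply: leq_trans (deg u uU); apply: sum_mem_le_card.
    move=> t t' tT tT' /(congr1 val) /=; rewrite !gE // => e; apply: val_inj => /=.
    have := winX u uX; have := winT t tT; have := winT t' tT'; lia.
  move=> t tT gU; rewrite inE gU; apply/existsP; exists t; rewrite tT /= gE //.
  by apply/eqP; have := winX u uX; have := winT t tT; lia.
have sY t : t \in T -> (\sum_(u in X) (g u t \in Y) <= #|Y|)%N.
  move=> tT; apply: (sum_mem_le_card (g := g^~ t)) => //.
  move=> u u' uX uX' /(congr1 val) /=; rewrite !gE // => e; apply: val_inj => /=.
  have := winX u uX; have := winX u' uX'; have := winT t tT; lia.
have tot : (#|X| * (17 * K) = \sum_(u in X) \sum_(t in T) (g u t \in U) +
    \sum_(t in T) \sum_(u in X) (g u t \in Y))%N.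
  rewrite [X in (_ + X)%N]exchange_big /= -big_split /= -cT -sum_nat_const.
  apply: eq_bigr => u uX; rewrite -big_split /= -sum1_card.
  by apply: eq_bigr => t tT; rewrite in_setD gV // andbT; case: (_ \in U).
have h1 : (\sum_(u in X) \sum_(t in T) (g u t \in U) <= #|X| * K)%N.
  by rewrite -sum_nat_const; apply: leq_sum.
have h2 : (\sum_(t in T) \sum_(u in X) (g u t \in Y) <= 17 * K * #|Y|)%N.
  by rewrite -cT -sum_nat_const; apply: leq_sum.
(* This is 17K|X| <= K|X| + 17K|Y| divided by K. *)
have h3 : (16 * #|X| <= 17 * #|Y|)%N by nia.
have h4 : (#|U| + #|Y| <= n)%N.
  have := cardsID U V; rewrite (setIidPr UV) => ->.
  by apply: leq_trans (card_window _ _ _) _; lia.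
have h5 : (#|U| <= #|X| + m)%N.
  rewrite -(cardsID (window N a (N - 2 * a - m).+1) U) leq_add2l.
  apply: leq_trans (_ : #|window N (N - 2 * a - m).+1 (N - 2 * a).+1| <= _)%N.
    apply/subset_leq_card/subsetP => u; rewrite in_setD => /andP[uW /(subsetP UV)].
    by move: uW; rewrite !inE; lia.
  by apply: leq_trans (card_window _ _ _) _; lia.
(* Now 16(|U| - m) <= 17(n - |U|), hence 33|U| <= 17n + 16m <= 21n since 4m <= n. *)
lia.
Qed.

(** * Avoiding sets inside [a, N - 2a] *)

Definition sum3_avoiding N (A : {set 'I_N}) : bool :=
  [forall x in A, forall y in A, forall z in A, (x + y + z)%N != N].

Lemma sum3_avoidingP N (A : {set 'I_N}) :
  reflect (forall x y z, x \in A -> y \in A -> z \in A -> (x + y + z)%N != N)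
          (sum3_avoiding A).
Proof.
apply: (iffP forall_inP) => [h x y z xA yA zA|h x xA].
  by have /forall_inP/(_ y yA)/forall_inP/(_ z zA) := h x xA.
by apply/forall_inP => y yA; apply/forall_inP => z zA; apply: h.
Qed.

Lemma sum3_avoiding_indep N (A T U : {set 'I_N}) :
  sum3_avoiding A -> T \subset A -> A :&: U \in indep (link T) U.
Proof.
move=> /sum3_avoidingP Aav TA; apply/indepP; split; first exact: subsetIr.
move=> x y; rewrite !in_setI => /andP[xA _] /andP[yA _].
apply/exists_inP => -[t tT]; apply/negP; apply: Aav => //; exact: (subsetP TA).
Qed.

Definition core N a : {set {set 'I_N}} :=
  [set A : {set 'I_N} | [&& A \subset window N a (N - 2 * a).+1,
     [exists x in A, val x == a] & sum3_avoiding A]].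

(* The base 39/25 satisfies [2 ^ (7 / 11) < 39 / 25]. *)
Lemma card_core_many (R : realFieldType) N a n K (lam : R) :
  (0 < a)%N -> (3 * a <= N)%N -> n = (N - 3 * a).+1 -> (0 < K)%N ->
  1 <= lam -> 1 <= lam ^+ K * (lam - 1) ->
  #|[set A in core N a |
      (17 * K <= #|A :&: window N a (a + n %/ 4).+1|)%N]|%:R <=
  ((17 * K).+1 * n ^ (17 * K).+1)%:R * (lam ^+ n * (39 / 25) ^+ n).
Proof.
move=> a0 aN nE K0 lam1 lamK; set W := window _ _ (a + _).+1; set k := (17 * K)%N.
pose V0 := window N a (N - 2 * a).+1.
have n0 : (0 < n)%N by rewrite nE.
pose D := [set T : {set 'I_N} | (T \subset W) && (#|T| == k)].
have cD : (#|D| <= k.+1 * n ^ k.+1)%N.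
  apply: leq_trans (card_sets_lt k.+1 n0 (_ : (#|W| <= n)%N)).
    apply/subset_leq_card/subsetP => T; rewrite !inE => /andP[-> /eqP ->].
    by rewrite ltnSn.
  by apply: leq_trans (card_window _ _ _) _; lia.
have cV0 : (#|V0| <= n)%N by apply: leq_trans (card_window _ _ _) _; lia.
apply: le_trans (_ : \sum_(T in D) #|indep (link T) V0|%:R <= _); last first.
  apply: le_trans (_ : \sum_(T in D) (lam ^+ n * (39 / 25) ^+ n) <= _).
    apply: ler_sum => T; rewrite inE => /andP[TW /eqP cT].
    apply: le_trans (card_indep_greedy (B := (39 / 25) ^+ n) lam1 lamK _ (subxx V0)) _.
      move=> U UV deg.
      have h : (11 * #|U| <= 7 * n)%N.
        by apply: (card_terminal a0 aN nE _ K0 TW cT UV deg); lia.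
      have q0 : 0 <= 39 / 25 :> R by lra.
      (* In eleventh powers, [h] reduces the claim to 2^7 <= (39/25)^11. *)
      rewrite -(ler_pXn2r (n := 11%N)) ?nnegrE ?exprn_ge0 //.
      rewrite -!exprM mulnC (mulnC n).
      apply: le_trans (_ : 2 ^+ (7 * n) <= _); first by apply: ler_weXn2l => //; lra.
      by rewrite !exprM lerXn2r ?nnegrE ?exprn_ge0 //; lra.
    by apply: ler_wpM2r; [apply: exprn_ge0; lra | apply: ler_weXn2l].
  rewrite sumr_const -[X in X <= _]mulr_natl; apply: ler_wpM2r; last by rewrite ler_nat.
  by apply: mulr_ge0; apply: exprn_ge0; lra.
rewrite -natr_sum ler_nat.
(* Union bound: a set with at least [k] elements in [W] contains some [T] of [D], and is then
   independent for [link T]. *)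
apply: leq_trans (_ : #|\bigcup_(T in D) indep (link T) V0| <= _)%N.
  apply/subset_leq_card/subsetP => A; rewrite inE => /andP[].
  rewrite inE => /and3P[AV _ Aav] kA.
  have : (0 < #|[set T : {set 'I_N} | (T \subset A :&: W) && (#|T| == k)]|)%N.
    by rewrite cards_draws bin_gt0.
  rewrite card_gt0 => /set0Pn[T]; rewrite inE subsetI => /andP[/andP[TA TW] cT].
  apply/bigcupP; exists T; first by rewrite inE TW.
  by rewrite -(setIidPl AV); apply: sum3_avoiding_indep.
elim/big_rec2: _ => [|T F s _ IH]; first by rewrite cards0.
by apply: leq_trans (leq_card_setU _ _) _; rewrite leq_add2l.
Qed.

(** Only sums involving [a] itself are used. The reflection x -> N - a - x preserves the middle part
    [a + m + 1, N - 2a - m - 1], of size n - 2m - 2, and joins each element to its image; 7/4 is a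
    rational bound for the square root of 3. *)
Lemma card_core_few (R : realFieldType) N a n m k :
  (0 < a)%N -> (3 * a <= N)%N -> n = (N - 3 * a).+1 -> m = (n %/ 4)%N ->
  #|[set A in core N a | (#|A :&: window N a (a + m).+1| < k)%N]|%:R <=
  (k * n ^ k)%:R * (2 ^+ m.+1 * (7 / 4) ^+ (n - 2 * m - 2)) :> R.
Proof.
move=> a0 aN nE mE; set W := window _ _ _.
have n0 : (0 < n)%N by rewrite nE.
have aN' : (a < N)%N by lia.
pose e := link [set Ordinal aN'].
have eE x y : e x y = ((x + y + a)%N == N).
  apply/exists_inP/idP => [[t]|h]; first by rewrite inE => /eqP->.
  by exists (Ordinal aN'); rewrite // inE.
pose Y := window N (a + m).+1 (N - 2 * a).+1.
pose M := window N (a + m).+1 (N - 2 * a - m).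
pose L := window N (N - 2 * a - m) (N - 2 * a).+1.
have c1 := card_sets_lt k n0 (_ : (#|W| <= n)%N).
set S := [set _ | _] in c1.
set F := [set _ in _ | _].
have FSY : (#|F| <= #|S| * #|indep e Y|)%N.
  apply: (card_split (X := W) (Y := Y)) => A; rewrite inE => /andP[].
  rewrite inE => /and3P[AV Aa Aav] kA; split.
  - apply/subsetP => x /(subsetP AV); rewrite !inE; lia.
  - by rewrite inE subsetIr.
  - apply: sum3_avoiding_indep => //; rewrite sub1set.
    have /exists_inP[x xA /eqP xa] := Aa.
    by rewrite (_ : Ordinal _ = x) //; apply: val_inj.
have YML : (#|indep e Y| <= #|indep e M| * #|indep e L|)%N.
  by apply: card_indep_setU; apply/subsetP => x; rewrite !inE; lia.
have cL : (#|indep e L| <= 2 ^ m.+1)%N.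
  apply: leq_trans (card_indep_le2 _ _) _; rewrite leq_exp2l //.
  by apply: leq_trans (card_window _ _ _) _; lia.
have cM : #|indep e M|%:R <= (7 / 4) ^+ (n - 2 * m - 2) :> R.
  apply: le_trans (_ : (7 / 4) ^+ #|M| <= _).
    pose f (x : 'I_N) : 'I_N := insubd x (N - a - x)%N.
    have fE x : x \in M -> f x = (N - a - x)%N :> nat.
      by rewrite inE => xM; rewrite /f val_insubd ifT //; lia.
    have fM x : x \in M -> f x \in M.
      by move=> xM; move: (xM); rewrite !inE fE //; lia.
    apply: (card_indep_matching (f := f)); [lra | lra | move=> x xM].
    split; first exact: fM.
      by apply: val_inj; rewrite /= !fE ?fM //; move: xM; rewrite inE; lia.
    by rewrite eE fE //; move: xM; rewrite inE; lia.
  apply: ler_weXn2l; first by lra.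
  by apply: leq_trans (card_window _ _ _) _; lia.
apply: le_trans (_ : (#|S| * (#|indep e M| * #|indep e L|))%:R <= _).
  by rewrite ler_nat (leq_trans FSY) // leq_mul2l YML orbT.
rewrite natrM; apply: ler_pM => //.
  by rewrite ler_nat c1 //; apply: leq_trans (card_window _ _ _) _; lia.
rewrite natrM mulrC; apply: ler_pM => //.
by rewrite -natrX ler_nat.
Qed.

(* Absorbing polynomial factors, and the exponential bound for the core *)
From mathcomp Require Import all_classical all_reals all_analysis.
Import numFieldNormedType.Exports.

(** A weak Bernoulli inequality. *)
Lemma mulrn_le_exp (R : realDomainType) (y : R) n : 0 <= y ->
  n%:R * y <= (1 + y) ^+ n.
Proof.
move=> y0; elim: n => [|n IH]; first by rewrite mul0r expr0 ler01.
have h : 1 <= (1 + y) ^+ n by apply: exprn_ege1; lra.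
by rewrite exprS -natr1; nra.
Qed.

(** Induction on [k]: of the two square roots of [mu], one absorbs n^k and the other the additional
    factor n. *)
Lemma natrX_le_exp (R : realType) k (mu : R) : 1 < mu ->
  exists2 C : R, 0 <= C & forall n, (n ^ k)%:R <= C * mu ^+ n.
Proof.
elim: k mu => [|k IH] mu mu1.
  by exists 1 => // n; rewrite expn0 mul1r exprn_ege1 // ltW.
have s1 : 1 < Num.sqrt mu by rewrite -[1]sqrtr1 ltr_sqrt //; lra.
have sE : Num.sqrt mu ^+ 2 = mu by rewrite sqr_sqrtr //; lra.
set s := Num.sqrt mu in s1 sE.
have [C C0 hC] := IH s s1.
have y0 : 0 < s - 1 by lra.
exists (C / (s - 1)) => [|n]; first by apply: divr_ge0 => //; lra.
have h : n%:R <= s ^+ n / (s - 1).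
  rewrite ler_pdivlMr //; have := mulrn_le_exp n (ltW y0).
  by rewrite (_ : 1 + (s - 1) = s) //; ring.
rewrite expnSr natrM -sE -exprM mulnC exprM expr2.
apply: le_trans (ler_pM _ _ (hC n) h) _ => //.
by rewrite le_eqVlt; apply/orP; left; apply/eqP; ring.
Qed.

(** Supplies the degree threshold for the greedy branching. If K >= (lam - 1)^-2, then lam^K >=
    K(lam - 1) >= 1 / (lam - 1). *)
Lemma exp_mul_ge1 (R : realType) (lam : R) : 1 < lam ->
  exists2 K : nat, (0 < K)%N & 1 <= lam ^+ K * (lam - 1).
Proof.
move=> lam1; have y0 : 0 < lam - 1 by lra.
exists (Num.bound ((lam - 1) ^- 2)).+1 => //.
set K := _.+1.
have hK : (lam - 1) ^- 2 <= K%:R.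
  apply: le_trans (ltW (archi_boundP _)) _; last by rewrite ler_nat leqnSn.
  by rewrite invr_ge0 exprn_ge0 // ltW.
rewrite -ler_pdivrMr // mul1r.
have := mulrn_le_exp K (ltW y0); rewrite (_ : 1 + (lam - 1) = lam); last by ring.
apply: le_trans; rewrite -ler_pdivrMr //.
by apply: le_trans hK; rewrite expr2 invfM.
Qed.

Lemma card_core_le (R : realType) :
  exists2 C : R, 0 <= C & forall N a, (0 < a)%N -> (3 * a <= N)%N ->
    #|core N a|%:R <= C * (79 / 50) ^+ (N - 3 * a).
Proof.
(* The slack is chosen so that mu lam (39/25) and mu (63/40) are both at most sg, while sg^3 < 4. *)
pose lam : R := 201 / 200; pose mu : R := 501 / 500; pose sg : R := 79 / 50.
have lam1 : 1 < lam by rewrite /lam; lra.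
have mu1 : 1 < mu by rewrite /mu; lra.
have sg0 : 0 <= sg by rewrite /sg; lra.
have [K K0 lamK] := exp_mul_ge1 lam1.
have [C1 C10 hC1] := natrX_le_exp (17 * K).+1 mu1.
have [C2 C20 hC2] := natrX_le_exp (17 * K) mu1.
(* The factor [sg] pays for the window having N - 3a + 1 elements, and (7/4)^3 for rounding in the
   division by 4. *)
pose D1 := (17 * K).+1%:R * C1 * sg.
pose D2 := (17 * K)%:R * C2 * (2 * (7 / 4) ^+ 3 * sg).
have D10 : 0 <= D1 by rewrite /D1 !mulr_ge0.
have D20 : 0 <= D2 by rewrite /D2 !mulr_ge0 // exprn_ge0 //; lra.
exists (D1 + D2); first exact: addr_ge0.
move=> N a a0 aN; set n := (N - 3 * a)%N.
have many := card_core_many a0 aN (erefl n.+1) K0 (ltW lam1) lamK.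
have few := card_core_few R (17 * K) a0 aN (erefl n.+1) (erefl _).
set W := window _ _ _ in many few.
have -> : core N a = [set A in core N a | (17 * K <= #|A :&: W|)%N] :|:
                     [set A in core N a | (#|A :&: W| < 17 * K)%N].
  by apply/setP => A; rewrite !inE ltnNge -andb_orr orbN andbT.
apply: le_trans (_ : (#|[set A in core N a | (17 * K <= #|A :&: W|)%N]| +
   #|[set A in core N a | (#|A :&: W| < 17 * K)%N]|)%:R <= _).
  by rewrite ler_nat leq_card_setU.
rewrite natrD mulrDl; apply: lerD.
  apply: le_trans many _.
  rewrite natrM -/sg /D1.
  rewrite -[X in _ <= X]mulrA -exprS -[X in X <= _]mulrA -[X in _ <= X]mulrA.
  apply: ler_wpM2l => //.
  apply: le_trans (ler_wpM2r _ (hC1 n.+1)) _.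
    by apply: mulr_ge0; apply: exprn_ge0; rewrite /lam; lra.
  rewrite -mulrA; apply: ler_wpM2l => //; rewrite -!exprMn.
  by apply: lerXn2r; rewrite ?nnegrE /mu /lam /sg; lra.
apply: le_trans few _.
rewrite natrM /D2 -/sg.
rewrite -[X in X <= _]mulrA -[X in _ <= X]mulrA -[X in _ <= X]mulrA.
apply: ler_wpM2l => //.
set m := (n.+1 %/ 4)%N.
(* [2 * (7 / 4) ^ 2 < (63 / 40) ^ 4] *)
have h : 2 ^+ m.+1 * (7 / 4) ^+ (n.+1 - 2 * m - 2) <=
    (2 * (7 / 4) ^+ 3) * (63 / 40) ^+ n.+1 :> R.
  pose r := (n.+1 - 4 * m)%N.
  have nE : n.+1 = (4 * m + r)%N by rewrite /r /m; lia.
  have r3 : (r <= 3)%N by rewrite /r /m; lia.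
  have e1 : (n.+1 - 2 * m - 2 <= 2 * m + 3)%N by rewrite nE; lia.
  apply: le_trans (_ : 2 ^+ m.+1 * (7 / 4) ^+ (2 * m + 3) <= _).
    by apply: ler_wpM2l; [apply: exprn_ge0 | apply: ler_weXn2l => //; lra].
  apply: le_trans (_ : 2 * (7 / 4) ^+ 3 * (63 / 40) ^+ (4 * m) <= _); last first.
    apply: ler_wpM2l; first by rewrite mulr_ge0 // exprn_ge0 //; lra.
    by apply: ler_weXn2l; [lra | rewrite nE leq_addr].
  rewrite exprS exprD.
  rewrite (_ : 2 * 2 ^+ m * _ = 2 * (7 / 4) ^+ 3 * (2 ^+ m * (7 / 4) ^+ (2 * m))); last by ring.
  apply: ler_wpM2l; first by rewrite mulr_ge0 // exprn_ge0 //; lra.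
  rewrite !exprM -exprMn; apply: lerXn2r; rewrite ?nnegrE; lra.
apply: le_trans (ler_pM _ _ (hC2 n.+1) h) _ => //.
rewrite -[X in X <= _]mulrA; apply: ler_wpM2l => //.
rewrite mulrCA -exprMn -[X in _ <= X]mulrA -exprS; apply: ler_wpM2l.
  by rewrite mulr_ge0 // exprn_ge0 //; lra.
by apply: lerXn2r; rewrite ?nnegrE /mu /sg; lra.
Qed.

(** * Splitting by the least element *)

Definition avoiding_from N a : {set {set 'I_N}} :=
  [set A : {set 'I_N} | [&& A \subset window N a N,
     [exists x in A, val x == a] & sum3_avoiding A]].

Lemma card_avoiding_from N a : (0 < a)%N -> (3 * a <= N)%N ->
  (#|avoiding_from N a| <= #|core N a| * 4 ^ a)%N.
Proof.
move=> a0 aN; pose Y := window N (N - 2 * a).+1 N.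
apply: leq_trans (_ : #|core N a| * #|powerset Y| <= _)%N; last first.
  rewrite leq_mul2l card_powerset -[4%N]/(2 ^ 2)%N -expnM leq_exp2l //.
  by apply/orP; right; apply: leq_trans (card_window _ _ _) _; lia.
apply: (card_split (X := window N a (N - 2 * a).+1) (Y := Y)) => A.
rewrite inE => /and3P[AN /exists_inP[x xA /eqP xa] /sum3_avoidingP Aav].
split.
- apply/fintype.subsetP => y /(fintype.subsetP AN); rewrite !inE; lia.
- rewrite inE subsetIr /=; apply/andP; split.
    apply/exists_inP; exists x; last by apply/eqP.
    have {}xa : x = a :> nat by [].
    by rewrite !inE xA xa; lia.
  apply/sum3_avoidingP => u v w; rewrite !inE => /andP[uA _] /andP[vA _] /andP[wA _].
  exact: Aav.
- by rewrite powersetE subsetIr.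
Qed.

(** Positivity is imposed because ['I_N] contains 0 while [n] does not. *)
Definition avoiding N : {set {set 'I_N}} :=
  [set A : {set 'I_N} | [forall x in A, (0 < x)%N] && sum3_avoiding A].

Lemma card_avoiding N :
  (#|avoiding N| <= 2 ^ (N - (N %/ 3).+1) +
     \sum_(a < (N %/ 3).+1 | (0 < a)%N) #|avoiding_from N a|)%N.
Proof.
pose Y := window N (N %/ 3).+1 N.
apply: leq_trans (_ : #|powerset Y :|:
  \bigcup_(a < (N %/ 3).+1 | (0 < a)%N) avoiding_from N a| <= _)%N.
  apply/subset_leq_card/fintype.subsetP => A; rewrite inE => /andP[/forall_inP A0 Aav].
  rewrite inE powersetE.
  have [//|/subsetPn[x xA xY]] := boolP (A \subset Y); rewrite orFb.
  have [y yA ymin] := arg_minnP (fun i : 'I_N => val i) xA.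
  have y3 : (y < (N %/ 3).+1)%N.
    by have := ymin x xA; move: xY; rewrite inE; have := ltn_ord x; rewrite /=; lia.
  apply/bigcupP; exists (Ordinal y3); first exact: A0.
  rewrite inE Aav andbT; apply/andP; split.
    apply/fintype.subsetP => z zA; rewrite inE ltn_ord andbT; exact: ymin.
  by apply/exists_inP; exists y.
apply: leq_trans (leq_card_setU _ _) _; apply: leq_add.
  by rewrite card_powerset leq_exp2l // card_window.
elim/big_rec2: _ => [|T F s _ IH]; first by rewrite cards0.
by apply: leq_trans (leq_card_setU _ _) _; rewrite leq_add2l.
Qed.

Lemma card_sum3_avoiding_sets n :
  (#|` sum3_avoiding_sets n| <= #|avoiding n.+1|)%N.
Proof.
pose phi (A : {fset nat}) : {set 'I_n.+1} := [set i : 'I_n.+1 | val i \in A]%SET.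
have mem A x : A \in sum3_avoiding_sets n -> x \in A -> (0 < x < n.+1)%N.
  rewrite !inE fpowersetE /= => /andP[/fsubsetP h _] /h.
  by rewrite !inE mem_iota; lia.
have inj : {in sum3_avoiding_sets n &, injective phi}.
  move=> A B AS BS /setP e; apply/fsetP => x; apply/idP/idP => h.
    have /andP[_ xn] := mem A x AS h.
    by have := e (Ordinal xn); rewrite !inE /= h.
  have /andP[_ xn] := mem B x BS h.
  by have := e (Ordinal xn); rewrite !inE /= h.
rewrite cardE -(size_map phi); apply: uniq_leq_size.
  by rewrite map_inj_in_uniq ?fset_uniq.
move=> _ /mapP[A AS ->]; rewrite mem_enum inE; apply/andP; split.
  by apply/forall_inP => x; rewrite inE => /(mem A _ AS)/andP[].
apply/sum3_avoidingP => x y z; rewrite !inE => xA yA zA.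
move: AS; rewrite !inE /= => /andP[_]; apply: contra => /eqP e.
apply/imfsetP; exists ((val x, val y), val z); last by rewrite /= e addn1.
by rewrite !inE /= xA yA zA.
Qed.

(** * The geometric sum and the asymptotic bound *)

Lemma sum_exp_le (R : realFieldType) (q : R) n : 0 <= q -> q < 1 ->
  \sum_(i < n) q ^+ i <= (1 - q)^-1.
Proof.
move=> q0 q1; have s0 : 0 < 1 - q by lra.
rewrite -[X in _ <= X]mul1r ler_pdivlMr // mulrC.
have := subrX1 q n; have := exprn_ge0 n q0; lra.
Qed.

Lemma card_avoiding_le (R : realType) (rho : R) : 0 <= rho -> rho ^+ 3 = 4 ->
  exists2 C : R, 0 <= C & forall N, #|avoiding N|%:R <= C * rho ^+ N.
Proof.
move=> rho0 rho3; have [C C0 hC] := card_core_le R.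
pose sg : R := 79 / 50.
have sgrho : sg < rho.
  by rewrite -(ltr_pXn2r (n := 3%N)) ?nnegrE // ?rho3 /sg; lra.
have sg0 : 0 < sg by rewrite /sg; lra.
have rhop : 0 < rho := lt_trans sg0 sgrho.
pose q := sg / rho.
have q0 : 0 <= q by rewrite divr_ge0 // ltW.
have q1 : q < 1 by rewrite ltr_pdivrMr // mul1r.
have sgE : sg = q * rho by rewrite divfK // gt_eqF.
have iq : 0 <= (1 - q)^-1 by rewrite invr_ge0; lra.
exists (1 + C * (1 - q)^-1); first by rewrite addr_ge0 // mulr_ge0.
move=> N; have := card_avoiding N; rewrite -(ler_nat R) => /le_trans; apply.
rewrite natrD mulrDl mul1r natrX; apply: lerD.
  (* Compared in cubes, this is 3(N - floor(N/3) - 1) <= 2N. *)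
  rewrite -(ler_pXn2r (n := 3%N)) ?nnegrE ?exprn_ge0 //.
  rewrite -[X in _ <= X]exprM mulnC exprM rho3 -exprM.
  rewrite (_ : 4 = 2 ^+ 2 :> R); last by ring.
  by rewrite -exprM; apply: ler_weXn2l; [rewrite ler1n | lia].
rewrite natr_sum.
(* As rho^3 = 4, one has 4^a sg^(N - 3a) = rho^N q^(N - 3a). The exponent N - 3a is at least
   floor(N/3) - a, so reversing the index leaves a geometric sum in q. *)
apply: le_trans (_ : \sum_(a < (N %/ 3).+1) C * rho ^+ N * q ^+ (N %/ 3 - a) <= _).
  apply: le_trans (_ : \sum_(a < (N %/ 3).+1 | (0 < a)%N)
                         C * rho ^+ N * q ^+ (N %/ 3 - a) <= _); last first.
    rewrite [X in _ <= X](bigID (fun a : 'I__ => (0 < a)%N)) /= lerDl.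
    by apply: sumr_ge0 => a _; rewrite !mulr_ge0 // exprn_ge0.
  apply: ler_sum => a a0.
  have aN : (3 * a <= N)%N by have := ltn_ord a; lia.
  have := card_avoiding_from a0 aN; rewrite -(ler_nat R) => /le_trans; apply.
  rewrite natrM natrX -rho3 -exprM.
  apply: le_trans (ler_wpM2r (exprn_ge0 _ rho0) (hC N a a0 aN)) _.
  rewrite -/sg sgE exprMn -!mulrA; apply: ler_wpM2l => //.
  rewrite -exprD subnK // mulrC; apply: ler_wpM2l; first exact: exprn_ge0.
  by apply: ler_wiXn2l => //; [exact: ltW | lia].
rewrite -mulr_sumr (reindex_inj rev_ord_inj) /=.
rewrite -!mulrA; apply: ler_wpM2l => //; rewrite mulrC; apply: ler_wpM2r.
  exact: exprn_ge0.
rewrite (eq_bigr (fun i : 'I_(N %/ 3).+1 => q ^+ i)); first exact: sum_exp_le.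
by move=> i _; congr (_ ^+ _); rewrite subSS subKn // -ltnS.
Qed.

Unset Implicit Arguments.
Local Open Scope classical_set_scope.
Local Open Scope fset_scope.
Local Open Scope ring_scope.

Theorem theorem3p12 (R : realType) :
  (fun n : nat => #|` sum3_avoiding_sets n|%:R : R) =O_\oo
    (fun n : nat => 2 `^ (2 * n%:R / 3) : R).
Proof.
pose rho : R := 2 `^ (2 / 3).
have rho0 : 0 <= rho by exact: powR_ge0.
have rhoX n : 2 `^ (2 * n%:R / 3) = rho ^+ n.
  by rewrite -powR_mulrn // -powRrM; congr (_ `^ _); ring.
have rho3 : rho ^+ 3 = 4.
  rewrite -rhoX (_ : 2 * 3%:R / 3 = 2%:R); last by field.
  by rewrite powR_mulrn //; ring.
have [C C0 hC] := card_avoiding_le rho0 rho3.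
apply/eqOP; near=> k.
near=> n.
rewrite rhoX ger0_norm // ger0_norm ?exprn_ge0 //.
(* Passing from N = n + 1 back to n costs one factor [rho], so any k >= C rho serves as the
   constant. *)
apply: le_trans (_ : C * rho ^+ n.+1 <= _).
  by apply: le_trans (hC n.+1); rewrite ler_nat card_sum3_avoiding_sets.
rewrite exprS mulrA; apply: ler_wpM2r; first exact: exprn_ge0.
by near: k; apply: nbhs_pinfty_ge; rewrite num_real.
Unshelve. all: by end_near.
Qed.
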